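(* Let $H$ be a finite abelian group with exponent $e$, and let $S_1\subseteq H$ satisfy $0\notin S_1$ and $\ell S_1=S_1$ for all $\ell\in\mathbb{Z}_e^*$. Let $G=\mathbb{Z}_2\times H$ and $$S=(\{1\}\times S_1)\cup(\{0\}\times S_1)\cup\{(1,0)\}.$$ Let $p$ be a prime dividing $d=|S_1|$, let $f$ be the characteristic function of $S_1$, and suppose $f$ is $p^r$-plateaued over $H$ with $r\ge1$. Put $r_0=\min(r,v_p(d))$ (so $r_0\geq1$). Then for every $(x,y)\in G$, the Cayley graph $\mathrm{Cay}(G,S)$ has fractional revival between $(x+1,y)$ and $(x,y)$ at time $t=\pi/p^{r_0}$; specifically $e^{\imath t\lambda_g}=e^{\imath\pi/p^{r_0}}$ for $g\in\{0\}\times H$ and $e^{\imath t\lambda_g}=e^{-\imath\pi/p^{r_0}}$ for $g\in\{1\}\times H$, giving $(\cos(\pi/p^{r_0}),\ \imath\sin(\pi/p^{r_0}))$-fractional revival.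
   Context: $\mathbb{Z}_e^*=\{\ell:1\le\ell\le e-1,\gcd(\ell,e)=1\}$ and $\ell S_1=\{\ell s:s\in S_1\}$. $v_p(d)$ is the exponent of the highest power of $p$ dividing $d$. A class function over $H$ is $f:H\to\mathbb{Z}$ with $f(\ell x)=f(x)$ for all $x\in H$, $\ell\in\mathbb{Z}_e^*$. The Fourier transform is $\widehat{f}(\chi)=\sum_{x\in H}f(x)\overline{\chi(x)}$. A class function $f$ is $p^r$-plateaued over $H$ if there is an integer $k$ with $\widehat{f}(\chi)\equiv k\pmod{p^r}$ for every character $\chi$ of $H$, $r$ being the largest such exponent. $\mathrm{Cay}(G,S)$ has vertex set $G$, $u\sim v$ iff $u-v\in S$; $A$ its adjacency matrix, $H(t)=\exp(\imath tA)$; eigenvalues $\lambda_g=\sum_{s\in S}\chi_g(s)$. Fractional revival from $u$ to $v$ at time $t$ means $H(t)\mathbf{e}_u=\alpha\mathbf{e}_u+\beta\mathbf{e}_v$ for some $\alpha,\beta\in\mathbb{C}$ with $\beta\neq0$, $|\alpha|^2+|\beta|^2=1$. *)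

(* Defs.v *)
From HB Require Import structures.
From mathcomp Require Import all_boot all_order all_algebra.
From mathcomp Require Import all_classical all_reals all_analysis.
From mathcomp Require Import complex.

Set Implicit Arguments.
Unset Strict Implicit.
Unset Printing Implicit Defensive.

Import Order.TTheory GRing.Theory Num.Theory.
Import numFieldNormedType.Exports.
Local Open Scope ring_scope.
Local Open Scope complex_scope.

Definition is_exponent (H : finZmodType) (e : nat) : Prop :=
  (0 < e)%N /\ (forall x : H, x *+ e = 0) /\
  (forall m : nat, (0 < m)%N -> (forall x : H, x *+ m = 0) -> (e <= m)%N).

Definition is_character (R : realType) (H : finZmodType) (chi : H -> R[i]) : Prop :=
  chi 0 = 1 /\ forall a b : H, chi (a + b) = chi a * chi b.

Definition fourier (R : realType) (H : finZmodType) (f : H -> int) (chi : H -> R[i]) : R[i] :=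
  \sum_(x : H) (f x)%:~R * (chi x)^*.

Definition alg_int (R : realType) (z : R[i]) : Prop :=
  exists q : {poly int}, q \is monic /\ root (map_poly (fun c : int => c%:~R : R[i]) q) z.

Definition congr_mod (R : realType) (a b : R[i]) (m : nat) : Prop :=
  alg_int ((a - b) / m%:R).

Definition plateaued_cong (R : realType) (H : finZmodType) (f : H -> int) (q : nat) : Prop :=
  exists k : int, forall chi : H -> R[i], is_character chi -> congr_mod (fourier f chi) k%:~R q.

Definition plateaued (R : realType) (H : finZmodType) (f : H -> int) (p r : nat) : Prop :=
  plateaued_cong R f (p ^ r) /\ ~ plateaued_cong R f (p ^ r.+1).

Definition cayley_adj (G : finZmodType) (S : {set G}) : 'M[int]_#|G| :=
  \matrix_(i, j) ((enum_val i - enum_val j \in S) : nat)%:Z.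

(* H(t) = exp(i t A) = sum_k (i t)^k A^k / k!, split into real part
   sum_k (-1)^k t^(2k) A^(2k)/(2k)!  and imaginary part
   sum_k (-1)^k t^(2k+1) A^(2k+1)/(2k+1)!  (A has real entries). *)
Definition transition (R : realType) (n : nat) (A : 'M[int]_n) (t : R) : 'M[R[i]]_n :=
  \matrix_(u, v)
    (limn (fun n => \sum_(0 <= k < n) ((-1) ^+ k * t ^+ (2 * k) / ((2 * k)`!)%:R
                     * ((A ^+ (2 * k)) u v)%:~R : R)) +i*
     limn (fun n => \sum_(0 <= k < n) ((-1) ^+ k * t ^+ (2 * k).+1 / ((2 * k).+1`!)%:R
                     * ((A ^+ (2 * k).+1) u v)%:~R : R))).

Definition evec (R : realType) (G : finType) (u : G) : 'cV[R[i]]_#|G| :=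
  delta_mx (enum_rank u) 0.

Definition revival_eq (R : realType) (G : finZmodType) (S : {set G}) (u v : G) (t : R)
  (alpha beta : R[i]) : Prop :=
  transition (cayley_adj S) t *m evec R u = alpha *: evec R u + beta *: evec R v.

Definition fractional_revival (R : realType) (G : finZmodType) (S : {set G}) (u v : G) (t : R) : Prop :=
  exists alpha beta : R[i], beta != 0 /\ `|alpha| ^+ 2 + `|beta| ^+ 2 = 1 /\
    revival_eq S u v t alpha beta.

Definition expC (R : realType) (z : R[i]) : R[i] :=
  (expR (complex.Re z))%:C * (cos (complex.Im z) +i* sin (complex.Im z)).

Definition cay_eig (R : realType) (G : finZmodType) (S : {set G}) (chi : G -> R[i]) : R[i] :=
  \sum_(s in S) chi s.

(* make the product of two finite abelian groups a finZmodType *)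
HB.saturate prod.

(* Main.v *)
(* A character sum over S_1 is rational: averaging the stability of S_1 under
   s |-> l s over all l coprime to e expresses it through the sums of the x^l
   with x an e-th root of unity, which are integers.  Comparing with the trivial
   character, the plateaued condition forces p^r0 to divide every character sum
   of S_1.  The eigenvalue of Cay(G, S) at a character chi with eps = chi(1, 0)
   is (1 + eps) * (sum of chi over S_1) + eps, hence is 1 modulo 2 p^r0 if
   eps = 1 and is -1 if eps = -1, so exp(i t lambda) = cos t + i eps sin t.
   The translations of G are commuting unitary matrices, hence simultaneously
   diagonalizable, with characters as eigenvalues; therefore
   exp(i t A) = (cos t) I + i (sin t) T, with T the translation by (1, 0). *)

Require Import Defs.
From HB Require Import structures.
From mathcomp Require Import all_boot all_order all_algebra all_field.
From mathcomp Require Import all_classical all_reals all_analysis.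
From mathcomp Require Import complex.

Import Order.TTheory GRing.Theory Num.Theory.
Import numFieldNormedType.Exports.
Local Open Scope ring_scope.
Local Open Scope complex_scope.

(** * Rational algebraic integers and power sums of roots of unity *)

(** The integer polynomial factors through [rat], so its rational root moves from [F] to [algC],
    where a rational algebraic integer is an integer. *)
Lemma root_monic_int_rat (F : numFieldType) (q : {poly int}) (a : rat) :
  q \is monic -> root (map_poly (fun c : int => c%:~R : F) q) (ratr a) ->
  a \is a Num.int.
Proof.
move=> q_monic q_root.
have comp (K : numFieldType) : map_poly (fun c : int => c%:~R : K) q
    = map_poly ratr (map_poly (intr : int -> rat) q).
  by rewrite -map_poly_comp; apply: eq_map_poly => c; rewrite /= ratr_int.
rewrite -Cint_rat; apply: Cint_rat_Aint; first exact: Crat_rat.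
apply: (@root_monic_Aint (map_poly (fun c : int => c%:~R : algC) q)).
- move: q_root; rewrite (comp F) (comp algC).
  rewrite (fmorph_root (ratr : {rmorphism rat -> F})) => q_root.
  exact: rmorph_root.
- exact: monic_map.
- by apply/polyOverP => i; rewrite coef_map /= rpred_int.
Qed.

Lemma rat_alg_int_int (R : realType) (a : rat) :
  alg_int (ratr a : R[i]) -> a \is a Num.int.
Proof. by move=> [q [q_monic]]; exact: root_monic_int_rat. Qed.

(** Multiplication and division by [g] are inverse bijections between the two index sets. *)
Lemma sum_gcdn_eq (V : nmodType) (m g : nat) (F : nat -> V) : (0 < g)%N ->
  \sum_(l < m * g | gcdn l (m * g) == g) F l
    = \sum_(l < m | coprime l m) F (l * g)%N.
Proof.
move=> g_gt0.
have ltM (l : 'I_m) : (l * g < m * g)%N by rewrite ltn_mul2r g_gt0 ltn_ord.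
have ltD (l : 'I_(m * g)) : (l %/ g < m)%N by rewrite ltn_divLR.
rewrite (reindex_onto (fun l : 'I_m => Ordinal (ltM l))
                      (fun l : 'I_(m * g) => Ordinal (ltD l))).
  apply: eq_bigl => l; rewrite /= -val_eqE /= mulnK // eqxx andbT.
  by rewrite -muln_gcdl /coprime -[RHS](eqn_pmul2r g_gt0) mul1n.
move=> l /eqP gcdE; apply: val_inj => /=; rewrite divnK //.
by have := dvdn_gcdl l (m * g); rewrite gcdE.
Qed.

(* Grouping the l < n by gcd(l, n) writes the geometric sum, which is 0 or n, as
   the sum over g | n of the analogous sums for x^g and n / g. *)
Lemma coprime_power_sum_int (F : idomainType) (n : nat) (x : F) :
  (0 < n)%N -> x ^+ n = 1 ->
  exists m : int, \sum_(l < n | coprime l n) x ^+ l = m%:~R.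
Proof.
elim/ltn_ind: n x => n IH x n_gt0 xn1.
have [total totalE] : exists m : int, \sum_(l < n) x ^+ l = m%:~R.
  have [->|x_neq1] := eqVneq x 1.
    exists n%:Z; rewrite (eq_bigr (fun=> 1)) => [|l _]; last by rewrite expr1n.
    by rewrite sumr_const card_ord.
  exists 0; have /eqP : (x - 1) * \sum_(l < n) x ^+ l = 0.
    by rewrite -subrX1 xn1 subrr.
  by rewrite mulf_eq0 subr_eq0 (negPf x_neq1) => /eqP.
have lt_gcd (l : 'I_n) : (gcdn l n < n.+1)%N.
  by rewrite ltnS dvdn_leq // dvdn_gcdr.
have n_gt : (1 < n.+1)%N by [].
move: totalE; rewrite (partition_big (fun l => Ordinal (lt_gcd l)) xpredT) //.
(* The class of gcd 1 is the wanted sum; every other class will be an integer by induction. *)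
rewrite (bigD1 (Ordinal n_gt)) //=.
set rest := (X in _ + X = _) => totalE.
have [m restE] : exists m : int, rest = m%:~R.
  rewrite /rest.
  apply: (big_ind (fun y : F => exists m : int, y = m%:~R)).
  - by exists 0.
  - by move=> _ _ [m1 ->] [m2 ->]; exists (m1 + m2); rewrite intrD.
  move=> g; rewrite -val_eqE /= => g_neq1.
  (* A [g] that does not divide [n] is no gcd, so its class is empty; this also disposes of
     [g = 0]. *)
  have [g_dvd|g_ndvd] := boolP (g %| n)%N; last first.
    exists 0; rewrite big_pred0 // => l; apply/negbTE; apply: contra g_ndvd.
    by rewrite -val_eqE /= => /eqP <-; exact: dvdn_gcdr.
  have g_gt0 : (0 < g)%N := dvdn_gt0 n_gt0 g_dvd.
  have g_gt1 : (1 < g)%N by rewrite ltn_neqAle eq_sym g_neq1.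
  have [k kE] : exists k : int,
      \sum_(l < n %/ g | coprime l (n %/ g)) (x ^+ g) ^+ l = k%:~R.
    apply: IH; first exact: ltn_Pdiv.
    - by rewrite divn_gt0 // dvdn_leq.
    - by rewrite -exprM mulnC divnK.
  exists k; rewrite -kE.
  under eq_bigl do rewrite -val_eqE /=.
  under [RHS]eq_bigr do rewrite -exprM mulnC.
  by rewrite -(@sum_gcdn_eq _ (n %/ g) g (GRing.exp x)) // divnK.
exists (total - m); rewrite intrB -totalE -restE addrK.
by apply: eq_bigl => l; rewrite -val_eqE.
Qed.

(** * Rationality of character sums over a stable set *)

Section Character.
Variables (R : realType) (G : finZmodType) (chi : G -> R[i]).
Hypothesis chi_char : is_character chi.

Lemma characterMn (a : G) (n : nat) : chi (a *+ n) = chi a ^+ n.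
Proof.
have [chi0 chiD] := chi_char.
by elim: n => [|n IH]; rewrite ?mulr0n ?expr0 // mulrS exprS chiD IH.
Qed.

Lemma character_sum_rat (e : nat) (S1 : {set G}) :
  (1 < e)%N -> (forall x : G, x *+ e = 0) ->
  (forall l : nat, (1 <= l <= e.-1)%N -> coprime l e ->
     [set s *+ l | s in S1] = S1) ->
  exists a : rat, \sum_(s in S1) chi s = ratr a.
Proof.
move=> e_gt1 Ge0 S1_stable; have e_gt0 := ltnW e_gt1.
have sum_pow (l : 'I_e) : coprime l e ->
    \sum_(s in S1) chi s ^+ l = \sum_(s in S1) chi s.
  move=> co_le.
  have l_gt0 : (0 < l)%N.
    rewrite lt0n; apply: contraL co_le => /eqP ->.
    by rewrite /coprime gcd0n neq_ltn e_gt1 orbT.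
  have im_l : [set s *+ l | s in S1] = S1.
    by apply: S1_stable; rewrite // l_gt0 /= -ltnS prednK ?ltn_ord.
  (* Multiplication by [l] maps the finite set [S1] onto itself, hence is injective on it. *)
  rewrite -[in RHS]im_l big_imset /=; last by apply/imset_injP; rewrite im_l.
  by apply: eq_bigr => s _; rewrite characterMn.
(* [N] is Euler's totient of [e], the number of copies of the sum in the average; [l = 1] shows that
   it is positive. *)
pose N := (\sum_(l < e | coprime l e) 1)%N.
have N_gt0 : (0 < N)%N.
  by rewrite /N (bigD1 (Ordinal e_gt1)) //= coprime1n.
have [m mE] : exists m : int,
    \sum_(s in S1) \sum_(l < e | coprime l e) chi s ^+ l = m%:~R.
  apply: (big_ind (fun y : R[i] => exists m : int, y = m%:~R)).
  - by exists 0.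
  - by move=> _ _ [m1 ->] [m2 ->]; exists (m1 + m2); rewrite intrD.
  move=> s _; apply: coprime_power_sum_int => //.
  by rewrite -characterMn Ge0; case: chi_char.
exists (m%:~R / N%:R); rewrite fmorph_div /= ratr_int ratr_nat -mE exchange_big /=.
rewrite [in RHS](eq_bigr (fun=> \sum_(s in S1) chi s)) => [|l co_le]; last exact: sum_pow.
apply: (canRL (mulfK _)); first by rewrite pnatr_eq0 -lt0n.
by rewrite big_const iter_addr_0 /N sum1_card mulr_natr.
Qed.

End Character.

(** * Translation matrices and their common eigenbasis *)

(** The regular representation: the permutation matrix sending the basis vector of v to that of a +
    v. *)
Definition translation_mx (C : pzRingType) (G : finZmodType) (a : G) : 'M[C]_#|G| :=
  \matrix_(i, j) (enum_val i - enum_val j == a)%:R.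

Section Translation.
Variables (C : numClosedFieldType) (G : finZmodType).
Local Notation T := (translation_mx C G).

Lemma translation_mx0 : T 0 = 1%:M.
Proof.
by apply/matrixP => i j; rewrite !mxE subr_eq0 (inj_eq enum_val_inj).
Qed.

Lemma translation_mxD (a b : G) : T (a + b) = T a *m T b.
Proof.
apply/matrixP => i j; rewrite !mxE.
(* Row [i] of the first factor has its only nonzero entry in the column of [enum_val i - a]. *)
rewrite (bigD1 (enum_rank (enum_val i - a))) //= big1 => [|k k_neq].
  by rewrite !mxE enum_rankK subKr eqxx mul1r addr0 addrAC [in RHS]subr_eq [b + a]addrC.
rewrite !mxE; case: eqP => [kE|]; last by rewrite mul0r.
by rewrite -kE subKr enum_valK eqxx in k_neq.
Qed.

Lemma translation_mx_comm (a b : G) : T a *m T b = T b *m T a.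
Proof. by rewrite -!translation_mxD addrC. Qed.

Lemma translation_mx_adj (a : G) : map_mx Num.conj (T a)^T = T (- a).
Proof.
apply/matrixP => i j; rewrite !mxE conjC_nat -[in RHS]opprB.
by rewrite (inj_eq oppr_inj).
Qed.


(** The adjoint is the translation by [- a], which commutes with [T a]; so [T a] is normal and the
    spectral theorem applies. *)
Lemma translation_mx_diagonalizable (a : G) : diagonalizable (T a).
Proof.
have /orthomx_spectralP TE : T a \is normalmx.
  by apply/normalmxP; rewrite translation_mx_adj translation_mx_comm.
have spec_unit := spectral_unit (T a).
exists (spectralmx (T a)) => //.
apply/(similar_diagLR spec_unit); exists (spectral_diag (T a)).
by rewrite conjVmx.
Qed.

(** In a common eigenbasis each diagonal entry is multiplicative in [a], because [T] is a
    homomorphism; the eigenvalues are thus characters. *)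
Lemma translation_mx_codiagonalizable :
  exists2 P : 'M[C]_#|G|, P \in unitmx &
  exists2 chi : 'I_#|G| -> G -> C,
    forall a, T a = invmx P *m diag_mx (\row_i chi i a) *m P &
    forall i, chi i 0 = 1 /\ forall a b, chi i (a + b) = chi i a * chi i b.
Proof.
have /codiagonalizableP[P P_unit /allP /= Pdiag] :
    {in [seq T a | a : G] &, forall A B, comm_mx A B} /\
    {in [seq T a | a : G], forall A, diagonalizable A}.
  split=> [_ _ /mapP[a _ ->] /mapP[b _ ->]|_ /mapP[a _ ->]].
    exact: translation_mx_comm.
  exact: translation_mx_diagonalizable.
pose D a := P *m T a *m invmx P.
have DE a : D a = diag_mx (\row_i D a i i).
  have Ta_in : T a \in [seq T a | a : G] by apply: map_f; rewrite mem_enum.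
  have /(similar_diagP _ P_unit) Da0 := Pdiag _ Ta_in.
  apply/matrixP => i j; rewrite [RHS]mxE [X in X *+ _]mxE.
  by have [->|ij] := eqVneq i j; rewrite ?mulr1n // mulr0n Da0.
have DD a b : D (a + b) = D a *m D b.
  by rewrite /D translation_mxD !mulmxA mulmxKV.
exists P => //; exists (fun i a => D a i i) => [a|i].
  by rewrite -DE /D !mulmxA mulVmx // mul1mx mulmxKV.
split; first by rewrite /D translation_mx0 mulmx1 mulmxV // mxE eqxx.
by move=> a b; rewrite DD {1}DE mul_diag_mx !mxE.
Qed.

End Translation.

(** * Spectral form of the powers of the adjacency matrix *)

Lemma cayley_adj_translation (C : pzRingType) (G : finZmodType) (S : {set G}) :
  map_mx intr (cayley_adj S) = \sum_(s in S) translation_mx C G s.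
Proof.
apply/matrixP => i j; rewrite summxE !mxE.
have [ijS|ijS] := boolP (enum_val i - enum_val j \in S).
  rewrite (bigD1 (enum_val i - enum_val j)) //= big1 ?mxE ?eqxx ?addr0 // => s.
  by case/andP=> _ /negPf s_neq; rewrite mxE eq_sym s_neq.
rewrite big1 // => s sS; rewrite mxE; case: eqP => // sE.
by rewrite sE sS in ijS.
Qed.

Lemma intr_mx_exp (C : pzRingType) (n : nat) (A : 'M[int]_n) (k : nat) :
  map_mx intr (A ^+ k) = map_mx intr A ^+ k :> 'M[C]_n.
Proof.
elim: k => [|k IH]; first by rewrite !expr0 map_mx1.
by rewrite !exprS -IH map_mxM.
Qed.

Lemma conj_diag_mx_exp (C : comUnitRingType) (n : nat) (P : 'M[C]_n) (d : 'I_n -> C)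
    (k : nat) : P \in unitmx ->
  (invmx P *m diag_mx (\row_i d i) *m P) ^+ k
    = invmx P *m diag_mx (\row_i d i ^+ k) *m P.
Proof.
move=> P_unit; elim: k => [|k IH].
  rewrite expr0 (_ : \row_i d i ^+ 0 = const_mx 1).
    by rewrite diag_const_mx mulmx1 mulVmx.
  by apply/rowP => i; rewrite !mxE expr0.
rewrite exprS IH -[_ * _]/(_ *m _) !mulmxA mulmxK //.
rewrite -!mulmxA; congr (_ *m _); rewrite !mulmxA; congr (_ *m _).
apply/matrixP => i j; rewrite mul_diag_mx !mxE exprS.
by case: eqP => [->|_]; rewrite ?mulr1n // mulr0n mulr0.
Qed.

(** The coefficients [c] come from the common eigenbasis alone, so the same ones expand translations
    and powers of every adjacency matrix; this makes the two comparable entry by entry. *)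
Lemma cayley_adj_spectrum (C : numClosedFieldType) (G : finZmodType) :
  exists c : 'I_#|G| -> 'I_#|G| -> 'I_#|G| -> C,
  exists2 chi : 'I_#|G| -> G -> C,
    forall i, chi i 0 = 1 /\ forall a b, chi i (a + b) = chi i a * chi i b &
    (forall a u v, translation_mx C G a u v = \sum_i c u v i * chi i a) /\
    (forall S k u v, ((cayley_adj S ^+ k) u v)%:~R
       = \sum_i c u v i * (\sum_(s in S) chi i s) ^+ k).
Proof.
have [P P_unit [chi TE chi_char]] := @translation_mx_codiagonalizable C G.
exists (fun u v i => invmx P u i * P i v); exists chi => //.
have entry d u v : (invmx P *m diag_mx (\row_i d i) *m P) u v
    = \sum_i invmx P u i * P i v * d i.
  rewrite mxE; apply: eq_bigr => i _.
  by rewrite mul_mx_diag !mxE mulrAC.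
split=> [a u v|S k u v]; first by rewrite TE entry.
rewrite -entry -conj_diag_mx_exp //.
have -> : invmx P *m diag_mx (\row_i \sum_(s in S) chi i s) *m P
    = map_mx intr (cayley_adj S).
  rewrite cayley_adj_translation (eq_bigr _ (fun s _ => TE s)).
  rewrite -mulmx_suml -mulmx_sumr; congr (_ *m _ *m _).
  apply/matrixP => i j; rewrite summxE !mxE -sumrMnl; apply: eq_bigr => s _.
  by rewrite !mxE.
by rewrite -intr_mx_exp mxE.
Qed.

(** * The transition matrix in terms of the eigenvalues *)

Lemma lim_series_linear (R : realType) (n : nat) (c l : 'I_n -> R)
    (f : nat -> R) (g : 'I_n -> nat -> R) :
  (forall i, (series (g i) @ \oo --> l i)%classic) ->
  (forall k, f k = \sum_i c i * g i k) ->
  limn (fun N => \sum_(0 <= k < N) f k) = \sum_i c i * l i.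
Proof.
move=> g_cvg fE; apply/cvg_lim => //.
have -> : (fun N => \sum_(0 <= k < N) f k) = \sum_i (fun N => c i * series (g i) N).
  apply/funext => N; rewrite fct_sumE.
  under eq_bigr do rewrite fE.
  by rewrite exchange_big; apply: eq_bigr => i _; rewrite -mulr_sumr.
apply: (big_ind2 (fun (u : nat -> R) (v : R) => (u @ \oo --> v)%classic)).
- exact: cvg_cst.
- by move=> u1 v1 u2 v2; exact: cvgD.
- by move=> i _; exact: cvgMl_tmp.
Qed.

(** Expanding the powers of [A] turns the even and odd parts of the exponential series into
    combinations of the cosine and sine series at [t * x i]. *)
Lemma transition_spectral (R : realType) (n m : nat) (A : 'M[int]_n) (t : R)
    (u v : 'I_n) (c x : 'I_m -> R) :
  (forall k, ((A ^+ k) u v)%:~R = \sum_i c i * x i ^+ k) ->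
  transition A t u v
    = (\sum_i c i * cos (t * x i)) +i* (\sum_i c i * sin (t * x i)).
Proof.
move=> A_exp; rewrite mxE; congr (_ +i* _).
- apply: (lim_series_linear _ _ _ _ _ _ (fun i => @cvg_cos_coeff' R (t * x i))) => k.
  rewrite A_exp mulr_sumr; apply: eq_bigr => i _.
  by rewrite /cos_coeff' mul2n exprMn mulrCA mulrAC !mulrA.
- apply: (lim_series_linear _ _ _ _ _ _ (fun i => @cvg_sin_coeff' R (t * x i))) => k.
  rewrite A_exp mulr_sumr; apply: eq_bigr => i _.
  by rewrite /sin_coeff' mul2n exprMn mulrCA mulrAC !mulrA.
Qed.

Lemma cosD2npi (R : realType) (x : R) (m : int) : cos (x + m%:~R * (pi *+ 2)) = cos x.
Proof.
have nat_period (y : R) (n : nat) : cos (y + n%:R * (pi *+ 2)) = cos y.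
  by rewrite mulr_natl periodicn //; exact: cosD2pi.
case: m => n; first exact: nat_period.
by rewrite NegzE -(nat_period _ n.+1) mulrNz mulNr subrK.
Qed.

Lemma sinD2npi (R : realType) (x : R) (m : int) : sin (x + m%:~R * (pi *+ 2)) = sin x.
Proof.
have nat_period (y : R) (n : nat) : sin (y + n%:R * (pi *+ 2)) = sin y.
  by rewrite mulr_natl periodicn //; exact: sinD2pi.
case: m => n; first exact: nat_period.
by rewrite NegzE -(nat_period _ n.+1) mulrNz mulNr subrK.
Qed.

Section Complex.
Variable R : realType.
Implicit Types z w : R[i].

Lemma Re_sum (I : Type) (s : seq I) (F : I -> R[i]) :
  complex.Re (\sum_(i <- s) F i) = \sum_(i <- s) complex.Re (F i).
Proof.
by apply: (big_ind2 (fun z x => complex.Re z = x)) => // -[? ?] _ [? ?] _ <- <-.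
Qed.

Lemma Re_mulr_real z (x : R) : complex.Re (z * x%:C) = complex.Re z * x.
Proof. by case: z => a b /=; rewrite mulr0 subr0. Qed.

Lemma mul_i_real (x : R) : 'i * x%:C = 0 +i* x :> R[i].
Proof. by rewrite -complexiE; apply/eqP; rewrite eq_complex /=; simpc. Qed.

Lemma expC_imaginary (x : R) : expC ('i * x%:C) = cos x +i* sin x.
Proof. by rewrite mul_i_real /expC /= expR0 rmorph1 mul1r. Qed.

Lemma expC_opp_imaginary (x : R) : expC (- ('i * x%:C)) = cos x +i* - sin x.
Proof.
by rewrite mul_i_real /expC /= oppr0 expR0 rmorph1 mul1r cosN sinN.
Qed.

End Complex.

(** Under the hypothesis the cosine sum becomes cos t times the expansion of the identity, and the
    sine sum becomes sin t times that of the translation by [w]. *)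
Lemma transition_two_term (R : realType) (G : finZmodType) (S : {set G}) (w : G) (t : R) :
  (forall chi : G -> R[i], is_character chi -> exists n : int,
     [/\ cay_eig S chi = n%:~R, cos (t * n%:~R) = cos t
       & (sin (t * n%:~R))%:C = chi w * (sin t)%:C]) ->
  transition (cayley_adj S) t
    = (cos t)%:C%:M + ('i * (sin t)%:C) *: translation_mx R[i] G w.
Proof.
move=> eigP; apply/matrixP => u v.
have [c [chi chi_char [TE AE]]] := @cayley_adj_spectrum R[i] G.
have [n nP] := choice (fun i => eigP (chi i) (chi_char i)).
(* The [c u v i] may be non-real, but entries and eigenvalues are integers, so taking real parts
   keeps the identity. *)
have A_exp k : ((cayley_adj S ^+ k) u v)%:~R
    = \sum_i complex.Re (c u v i) * (n i)%:~R ^+ k :> R.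
  have /(congr1 (@complex.Re R)) := AE S k u v.
  rewrite -(rmorph_int (real_complex R)) /= => ->.
  rewrite Re_sum; apply: eq_bigr => i _.
  have [eigE _ _] := nP i.
  rewrite -[\sum_(s in S) _]/(cay_eig S (chi i)) eigE.
  by rewrite -(rmorph_int (real_complex R)) -rmorphXn Re_mulr_real.
rewrite (transition_spectral _ _ _ _ _ _ _ _ _ A_exp).
have -> : \sum_i complex.Re (c u v i) * cos (t * (n i)%:~R)
    = cos t * (u == v)%:R.
  (* The identity is the translation by 0, where all characters equal 1. *)
  have -> : (u == v)%:R = \sum_i complex.Re (c u v i) :> R.
    have /(congr1 (@complex.Re R)) := TE 0 u v.
    rewrite translation_mx0 mxE -(rmorph_nat (real_complex R)) /= => ->.
    rewrite Re_sum; apply: eq_bigr => i _.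
    by have [-> _] := chi_char i; rewrite mulr1.
  by rewrite mulr_sumr; apply: eq_bigr => i _; have [_ -> _] := nP i; rewrite mulrC.
have -> : \sum_i complex.Re (c u v i) * sin (t * (n i)%:~R)
    = sin t * (enum_val u - enum_val v == w)%:R.
  have -> : (enum_val u - enum_val v == w)%:R
      = \sum_i complex.Re (c u v i * chi i w) :> R.
    have /(congr1 (@complex.Re R)) := TE w u v.
    by rewrite mxE -(rmorph_nat (real_complex R)) /= => ->; rewrite Re_sum.
  (* The product of [chi i w] and [sin t] is the real number [sin (t * n i)], so it can pass in and
     out of the real part. *)
  rewrite mulr_sumr; apply: eq_bigr => i _; have [_ _ sinE] := nP i.
  by rewrite -Re_mulr_real sinE mulrA Re_mulr_real mulrC.
rewrite !mxE mul_i_real.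
case: (u == v); case: (_ == w);
  rewrite ?mulr1n ?mulr0n ?mulr1 ?mulr0; apply/eqP;
  by rewrite eq_complex /= ?(addr0, add0r, mulr0, mul0r, subr0, eqxx).
Qed.

(** Column [u] of the translation by [w] is the basis vector of [w + u]. *)
Lemma revival_two_term (R : realType) (G : finZmodType) (S : {set G}) (w u : G) (t : R)
    (alpha beta : R[i]) :
  transition (cayley_adj S) t = alpha%:M + beta *: translation_mx R[i] G w ->
  revival_eq S u (w + u) t alpha beta.
Proof.
move=> trE; apply/matrixP => i j.
rewrite (ord1 j) /evec -colE trE !mxE enum_rankK subr_eq.
rewrite !andbT -(inj_eq enum_val_inj i (enum_rank (w + u))) enum_rankK.
by rewrite -[alpha *+ _]mulr_natr.
Qed.

(** * Divisibility of the character sums and the eigenvalues of the Cayley graph *)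

Section Fourier.
Variables (R : realType) (H : finZmodType) (S1 : {set H}).

Lemma fourier_indicator (chi : H -> R[i]) :
  fourier (fun x : H => ((x \in S1) : nat)%:Z) chi = (\sum_(s in S1) chi s)^*.
Proof.
rewrite rmorph_sum [RHS]big_mkcond; apply: eq_bigr => x _.
by case: (x \in S1); rewrite ?mul1r ?mul0r.
Qed.

Lemma alg_int0 : alg_int (0 : R[i]).
Proof. by exists 'X; rewrite monicX map_polyX rootX. Qed.

(** For empty [S1] the transform vanishes, so the congruence holds modulo every power of [p],
    against the maximality of [r]. *)
Lemma plateaued_nonempty (p r : nat) :
  plateaued R (fun x : H => ((x \in S1) : nat)%:Z) p r -> exists s, s \in S1.
Proof.
move=> [_ not_cong]; have [S1_0|[s sS1]] := set_0Vmem S1; last by exists s.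
exfalso; apply: not_cong; exists 0 => chi _.
rewrite /congr_mod fourier_indicator S1_0 big_set0 rmorph0 subrr mul0r.
exact: alg_int0.
Qed.

Lemma character_sum_dvd (e p r : nat) :
  is_exponent H e -> 0 \notin S1 ->
  (forall l : nat, (1 <= l <= e.-1)%N -> coprime l e ->
     [set s *+ l | s in S1] = S1) ->
  prime p ->
  plateaued R (fun x : H => ((x \in S1) : nat)%:Z) p r ->
  forall chi : H -> R[i], is_character chi ->
  exists m : int,
    \sum_(s in S1) chi s = (m * (p ^ minn r (logn p #|S1|))%N%:Z)%:~R.
Proof.
move=> [e_gt0 [He0 _]] S1_0 S1_stable p_prime plat chi chi_char.
(* Exponent 1 would make [H] trivial, and the nonempty [S1] would contain 0. *)
have e_gt1 : (1 < e)%N.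
  rewrite ltn_neqAle e_gt0 andbT eq_sym; apply/eqP => e1.
  have [s sS1] := plateaued_nonempty _ _ plat.
  by move: (He0 s) S1_0; rewrite e1 mulr1n => <-; rewrite sS1.
have [[k congk] _] := plat.
have p_gt0 := prime_gt0 p_prime.
(* The transform is the conjugate of the character sum, but that sum is rational, hence its own
   conjugate. *)
have cong_rat (psi : H -> R[i]) : is_character psi -> exists2 m : int,
    \sum_(s in S1) psi s = m%:~R & exists j : int, m = k + j * (p ^ r)%N%:Z.
  move=> psi_char.
  have [a aE] := character_sum_rat _ _ _ psi_char _ _ e_gt1 He0 S1_stable.
  have := congk psi psi_char.
  rewrite /congr_mod fourier_indicator aE fmorph_rat.
  rewrite -(ratr_int _ k) -(ratr_nat _ (p ^ r)) -rmorphB -fmorph_div.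
  move/rat_alg_int_int/intrP => [j jE].
  have aE' : a = (k + j * (p ^ r)%N%:Z)%:~R.
    rewrite intrD intrM -jE divfK ?pnatr_eq0 -?lt0n ?expn_gt0 ?p_gt0 //.
    by rewrite addrC subrK.
  exists (k + j * (p ^ r)%N%:Z); last by exists j.
  by rewrite aE' ratr_int.
have [m mE [j jE]] := cong_rat chi chi_char.
have triv_char : is_character (fun _ : H => 1 : R[i]).
  by split=> // *; rewrite mulr1.
have [d dE [j' j'E]] := cong_rat _ triv_char.
have {}dE : d = #|S1|%:Z.
  move: dE; rewrite sumr_const -[_ *+ _]/(#|S1|%:Z%:~R) => dE.
  by apply: (@intr_inj R[i]).
have /dvdzP[m' m'E] : ((p ^ minn r (logn p #|S1|))%N%:Z %| m)%Z.
  (* The trivial character has sum [#|S1|]; subtracting the two congruences eliminates [k]. *)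
  have -> : m = #|S1|%:Z + (j - j') * (p ^ r)%N%:Z.
    by rewrite -dE j'E jE mulrBl -addrA [j' * _ + _]addrC subrK.
  apply: rpredD; last apply: dvdz_mull; rewrite dvdzE /=.
    by apply: dvdn_trans (pfactor_dvdnn p _); rewrite dvdn_exp2l // geq_minr.
  by rewrite dvdn_exp2l // geq_minl.
by exists m'; rewrite mE m'E.
Qed.

(** The fibre of the set over 0 is [S1], and over 1 it is [S1] together with 0. As 0 is not in [S1],
    the element (1, 0) adds exactly one term. *)
Lemma cay_eig_double (chi : 'Z_2 * H -> R[i]) : is_character chi -> 0 \notin S1 ->
  cay_eig [set g : 'Z_2 * H | ((g.1 == 1) && (g.2 \in S1))
             || ((g.1 == 0) && (g.2 \in S1)) || (g == (1, 0))] chi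
  = (1 + chi (1, 0)) * (\sum_(s in S1) chi (0, s)) + chi (1, 0).
Proof.
move=> [_ chiD] S1_0.
set S := (X in cay_eig X _).
have S0E y : ((0, y) \in S) = (y \in S1) by rewrite inE /= orbF.
have S1E y : ((1, y) \in S) = (y \in S1) || (y == 0).
  by rewrite inE /= orbF -[(1, y) == _]/((1 == 1 :> 'Z_2) && (y == 0)) eqxx.
have chi1 y : chi (1, y) = chi (1, 0) * chi (0, y).
  by rewrite -chiD; congr (chi (_, _)); rewrite ?addr0 ?add0r.
pose F (x : 'Z_2) (y : H) := if (x, y) \in S then chi (x, y) else 0.
rewrite /cay_eig big_mkcond (eq_bigr (fun g => F g.1 g.2)) => [|[]//].
rewrite -(pair_bigA _ F) /= big_ord_recl big_ord1.
have -> : lift ord0 ord0 = 1 :> 'Z_2 by apply: val_inj.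
rewrite -[ord0]/(0 : 'Z_2) mulrDl mul1r -addrA; congr (_ + _).
  by rewrite [RHS]big_mkcond; apply: eq_bigr => y _; rewrite /F S0E.
rewrite mulr_sumr [X in _ = X + _]big_mkcond [in LHS](bigD1 0) //= [in RHS](bigD1 0) //=.
rewrite /F S1E eqxx orbT (negPf S1_0) add0r addrC; congr (_ + _).
by apply: eq_bigr => y /negPf y_neq0; rewrite S1E y_neq0 orbF chi1.
Qed.

End Fourier.

Theorem theorem3p6 (R : realType) (H : finZmodType) (e : nat) (S1 : {set H})
    (p r : nat) :
  is_exponent H e ->
  0 \notin S1 ->
  (forall l : nat, (1 <= l <= e.-1)%N -> coprime l e ->
     [set s *+ l | s in S1] = S1) ->
  prime p -> (p %| #|S1|)%N ->
  plateaued R (fun x : H => ((x \in S1) : nat)%:Z) p r -> (1 <= r)%N ->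
  let r0 := minn r (logn p #|S1|) in
  let t : R := pi / (p ^ r0)%:R in
  let S : {set 'Z_2 * H} :=
    [set g : 'Z_2 * H | ((g.1 == 1) && (g.2 \in S1))
                        || ((g.1 == 0) && (g.2 \in S1)) || (g == (1, 0))] in
  (forall (x : 'Z_2) (y : H),
     fractional_revival S (x + 1, y) (x, y) t /\
     revival_eq S (x + 1, y) (x, y) t
       (cos (pi / (p ^ r0)%:R))%:C ('i * (sin (pi / (p ^ r0)%:R))%:C)) /\
  (forall chi : 'Z_2 * H -> R[i], is_character chi -> chi (1, 0) = 1 ->
     expC ('i * t%:C * cay_eig S chi) = expC ('i * (pi / (p ^ r0)%:R)%:C)) /\
  (forall chi : 'Z_2 * H -> R[i], is_character chi -> chi (1, 0) <> 1 ->
     expC ('i * t%:C * cay_eig S chi) = expC (- ('i * (pi / (p ^ r0)%:R)%:C))).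
Proof.
move=> exp_e S1_0 S1_stable p_prime p_dvd plat r_gt0 r0 t S.
have [s0 s0S1] := plateaued_nonempty _ _ _ _ _ plat.
(* Nonemptiness of [S1] matters here: [p] has positive valuation only in a nonzero cardinal. *)
have r0_gt0 : (0 < r0)%N.
  rewrite leq_min r_gt0 logn_gt0 mem_primes p_prime p_dvd /= andbT.
  by apply/card_gt0P; exists s0.
have q_gt1 : (1 < p ^ r0)%N.
  by rewrite -(exp1n r0) ltn_exp2r // prime_gt1.
have q_neq0 : (p ^ r0)%:R != 0 :> R by rewrite pnatr_eq0 -lt0n ltnW.
(* Since (1, 0) has order 2, the value is a sign: 1 for the characters indexed by {0} x H, -1 for
   those indexed by {1} x H. *)
have char_w (chi : 'Z_2 * H -> R[i]) : is_character chi ->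
    chi (1, 0) = 1 \/ chi (1, 0) = -1.
  move=> [chi0 chiD].
  have /eqP : chi (1, 0) ^+ 2 = 1.
    by rewrite expr2 -chiD -chi0; congr chi; apply/eqP; rewrite xpair_eqE addr0 eqxx.
  by rewrite sqrf_eq1 => /orP[/eqP|/eqP]; [left|right].
have eigP (chi : 'Z_2 * H -> R[i]) : is_character chi -> exists n : int,
     [/\ cay_eig S chi = n%:~R, cos (t * n%:~R) = cos t
       & (sin (t * n%:~R))%:C = chi (1, 0) * (sin t)%:C].
  move=> chi_char; rewrite /S cay_eig_double //.
  have [->|->] := char_w chi chi_char; last first.
    exists (-1); rewrite subrr mul0r add0r; split.
    - by rewrite mulrN1z.
    - by rewrite mulrN1z mulrN mulr1 cosN.
    - by rewrite mulrN1z mulrN mulr1 sinN mulN1r rmorphN.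
  have chi_H : is_character (fun y => chi (0, y)).
    case: chi_char => chi0 chiD; split=> // y z.
    by rewrite -chiD; congr (chi (_, _)); rewrite addr0.
  have [m ->] := character_sum_dvd _ _ _ _ _ _ exp_e S1_0 S1_stable p_prime plat _ chi_H.
  (* Multiplied by t = pi / p^r0, this eigenvalue gives t plus [m] full periods. *)
  exists (2 * (m * (p ^ r0)%N%:Z) + 1).
  have -> : t * (2 * (m * (p ^ r0)%N%:Z) + 1)%:~R = t + m%:~R * (pi *+ 2).
    rewrite intrD !intrM mulrDr mulr1 addrC; congr (_ + _).
    rewrite /t mulrCA [m%:~R * _]mulrC [_ / _ * _]mulrA divfK //.
    by rewrite -[pi *+ 2]mulr_natl [RHS]mulrCA [pi * _]mulrC.
  by rewrite cosD2npi sinD2npi mul1r; split; rewrite // [RHS]intrD [in RHS]intrM.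
have expE (chi : 'Z_2 * H -> R[i]) : is_character chi ->
    expC ('i * t%:C * cay_eig S chi) = cos t +i* complex.Re (chi (1, 0) * (sin t)%:C).
  move=> chi_char; have [n [-> cosE sinE]] := eigP chi chi_char.
  rewrite -(rmorph_int (real_complex R)) -mulrA -rmorphM expC_imaginary cosE.
  by rewrite -sinE.
split; last split.
- have rev x y : revival_eq S (x + 1, y) (x, y) t (cos t)%:C ('i * (sin t)%:C).
    (* Holds because 1 + 1 = 0 in ['Z_2]. *)
    have -> : (x, y) = ((1, 0) : 'Z_2 * H) + (x + 1, y).
      congr (_, _); rewrite ?add0r // addrCA -[LHS]addr0; congr (_ + _).
      exact: val_inj.
    apply: revival_two_term; exact: transition_two_term.
  move=> x y; split; last exact: rev.
  exists (cos t)%:C, ('i * (sin t)%:C); split; last split; last exact: rev.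
    (* Since p^r0 > 1, the time lies strictly between 0 and pi, so its sine is positive and beta is
       nonzero. *)
    rewrite mul_i_real eq_complex /= eqxx /= gt_eqF //.
    apply: sin_gt0_pi; rewrite divr_gt0 ?pi_gt0 //= ?ltr0n ?(ltnW q_gt1) //.
    by rewrite ltr_pdivrMr ?ltr0n ?(ltnW q_gt1) // ltr_pMr ?pi_gt0 // ltr1n.
  rewrite mul_i_real -!add_Re2_Im2 /= !expr0n /= addr0 add0r -rmorphD /=.
  by rewrite cos2Dsin2.
- move=> chi chi_char w1; rewrite expE // w1 mul1r.
  exact/esym/expC_imaginary.
- move=> chi chi_char w1; rewrite expE //; have [//|->] := char_w chi chi_char.
  by rewrite mulN1r; exact/esym/expC_opp_imaginary.
Qed.
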